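(* Let $\kappa$ be an infinite cardinal with $\kappa^{<\kappa}=\kappa$, let $\varphi$ be a $\kappa$-scattered linear order type, and let $\nu$ be a cardinal. Then there is a $\kappa$-scattered linear order type $\psi$ such that $\psi\longrightarrow[\varphi]^1_{\nu,\kappa}$.
   Context: A linear order $P$ is $\kappa$-dense if $|P|>1$ and for all $a<_P b$ in $P$ the open interval between $a$ and $b$ in $P$ has cardinality at least $\kappa$. For infinite regular $\kappa$, a linear order (type) is $\kappa$-scattered if it has no $\kappa$-dense suborder. The relation $\psi\longrightarrow[\varphi]^1_{\nu,\kappa}$ means: whenever $P$ is a linear order of type $\psi$ and $f:P\to\nu$ is a function, there are $A\subseteq\nu$ with $|A|\leq\kappa$ and a suborder $Q\subseteq P$ of type $\varphi$ such that $f(q)\in A$ for all $q\in Q$. *)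

(* Defs.v *)
From mathcomp Require Import all_boot all_order all_classical.
Set Implicit Arguments.
Unset Strict Implicit.
Unset Printing Implicit Defensive.
Import Order.TTheory.
Local Open Scope order_scope.
Local Open Scope classical_set_scope.
Local Open Scope card_scope.

(* A cardinal is given by a type of that cardinality; cardinals are compared
   only through the library's [#<=] and [#=].  The name also fixes one universe
   for all cardinals.  Cardinal exponentiation is the function type. *)
Definition cardinal := Type.

Definition infinite_cardinal (kappa : cardinal) : Prop :=
  infinite_set [set: kappa].

Definition lt_cardinal (mu kappa : cardinal) : Prop :=
  [set: mu] #<= [set: kappa] /\ [set: mu] #!= [set: kappa].

(* kappa ^ (< kappa) = kappa, where the left-hand side is the supremum (least
   upper bound) of the cardinals kappa ^ mu for mu < kappa. *)
Definition weak_power_self (kappa : cardinal) : Prop :=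
  (forall mu : cardinal, lt_cardinal mu kappa ->
     [set: mu -> kappa] #<= [set: kappa]) /\
  (forall lambda : cardinal,
     (forall mu : cardinal, lt_cardinal mu kappa ->
        [set: mu -> kappa] #<= [set: lambda]) ->
     [set: kappa] #<= [set: lambda]).

(* A suborder of P is a subset with the induced order; P itself is setT. *)
Definition kdense (kappa : cardinal) d (P : orderType d) (Q : set P) : Prop :=
  ~ is_subset1 Q /\
  forall a b : P, Q a -> Q b -> a < b ->
    [set: kappa] #<= [set x : P | Q x /\ a < x < b].

Definition kscattered (kappa : cardinal) d (P : orderType d) : Prop :=
  forall Q : set P, ~ kdense kappa Q.

(* An order type is given by a representative phi. *)
Definition has_order_type d (P : orderType d) (Q : set P)
    d' (phi : orderType d') : Prop :=
  exists g : phi -> P, set_bij [set: phi] Q g /\ {mono g : x y / x <= y}.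

(* psi --> [phi]^1_{nu, kappa} *)
Definition arrow1 d (psi : orderType d) d' (phi : orderType d')
    (nu kappa : cardinal) : Prop :=
  forall d0 (P : orderType d0), has_order_type [set: P] psi ->
  forall f : P -> nu,
  exists (A : set nu) (Q : set P),
    [/\ A #<= [set: kappa],
        has_order_type Q phi
      & forall q : P, Q q -> A (f q)].

(* Main.v *)
(* A kappa-scattered order phi is built from subsingletons by sums along orders
   of size < kappa, well-orders and reversed well-orders: identifying x and y
   when the segment between them is so built, representatives of the classes
   would otherwise form a kappa-dense suborder. Since kappa^(<kappa) = kappa, one
   kappa-scattered order W of size at most kappa contains all orders of size
   < kappa, so a single index order J, the product of W, a well-order and a
   reversed well-order, serves for all these sums.

   Suppose that every scattered B has a colouring in which phi is not embedded
   in any kappa colours. Call a set h of pairs (colour set c, part Q of phi)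
   unavoidable if every nonempty scattered B has a colouring in which, for all
   (c, Q) in h, Q is not embedded in the colours of c. If h is unavoidable,
   colour a sum of copies of a large B along a product of W and of two very long
   well-orders, one of them reversed: by homogeneity this yields for each v in W
   a colour and an unavoidable set h_v, such that a pair (c, Q) in h whose c
   contains these colours passes to (c, Q') in some h_v, for a summand Q' of any
   given decomposition of Q along J. Iterating along the words over W uses at
   most kappa colours; with c the set of all of them, phi has an infinite
   descending chain of decompositions, which is absurd. *)
Require Import Defs.
From HB Require Import structures.
From mathcomp Require Import all_boot all_order all_classical.
From mathcomp Require Import wochoice.
Set Implicit Arguments.
Unset Strict Implicit.
Unset Printing Implicit Defensive.
Import Order.TTheory.
Local Open Scope classical_set_scope.
Local Open Scope card_scope.

Lemma card_leTP T U (X : set U) :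
  [set: T] #<= X <-> exists2 f : T -> U, injective f & forall t, X (f t).
Proof.
split=> [/card_leP[f]|[f finj fX]].
  exists (fun t => val (f (SigSub (mem_set (I : setT t))))) => [t t' /val_inj|t].
    by move/'inj_f => /(_ (in_setT _) (in_setT _)) [].
  exact: set_valP.
have /injfunPex/unsquash g : exists2 f : T -> U, set_fun setT X f & set_inj setT f.
  by exists f => // x y _ _; exact: finj.
exact: inj_card_le.
Qed.

(** * Linear orders and well-orders *)

Definition strict_total T (R : T -> T -> Prop) :=
  [/\ forall x, ~ R x x, forall x y z, R x y -> R y z -> R x z
    & forall x y, x <> y -> R x y \/ R y x].

Record linorder := Linorder {
  car :> Type;
  before : car -> car -> Prop;
  before_strict_total : strict_total before }.

Lemma before_irr (A : linorder) (x : A) : ~ before x x.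
Proof. by have [+ _ _] := before_strict_total A; apply. Qed.

Lemma before_trans (A : linorder) (x y z : A) : before x y -> before y z -> before x z.
Proof. by have [_ + _] := before_strict_total A; apply. Qed.

Lemma before_total (A : linorder) (x y : A) : x <> y -> before x y \/ before y x.
Proof. by have [_ _] := before_strict_total A; apply. Qed.

Definition mono_on (A B : linorder) (Q : set A) (e : A -> B) :=
  forall x y, Q x -> Q y -> before x y -> before (e x) (e y).

Lemma not_before (A : linorder) (x y : A) : ~ before x y -> x = y \/ before y x.
Proof.
move=> nxy; have [->|xy] := EM (x = y); first by left.
by have [/nxy//|] := before_total xy; right.
Qed.

Definition wellordered (A : linorder) :=
  forall X : set A, X !=set0 -> exists2 m, X m & forall x, X x -> ~ before x m.

Lemma wellordered_wf (A : linorder) : wellordered A -> well_founded (@before A).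
Proof.
move=> woA; apply: contrapT => /existsNP[x nx].
have [m nm min] := woA [set x | ~ Acc (@before A) x] (ex_intro _ x nx).
by apply: nm; constructor=> y ym; apply: contrapT => /min/(_ ym).
Qed.

Lemma well_ordering_strict (T : Type) :
  {R : T -> T -> Prop & {sR : strict_total R | wellordered (Linorder sR)}}.
Proof.
have [R woR] := @well_ordering_principle {classic T}.
have minR (X : set T) : X !=set0 -> exists2 m, X m & forall x, X x -> R m x.
  move=> [x Xx]; have [|m [[mX mmin] _]] := woR (mem X); first by exists x; apply/mem_set.
  by exists m => [|y Xy]; [exact/set_mem | apply/mmin/mem_set].
have min2 x y : R x y /\ R y x -> x = y.
  move=> [Rxy Ryx]; have [|m [_ mu]] := woR (mem [set x; y]).
    by exists x; apply/mem_set; left.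
  have Rr z : R z z by have [|m' -> /(_ z)] := minR [set z]; [exists z| apply].
  rewrite -(mu x) ?(mu y) //; split; try by apply/mem_set; (left + right).
    by move=> z /set_mem[]->.
  by move=> z /set_mem[]->.
have tot x y : R x y \/ R y x.
  have [|m + mmin] := minR [set x; y]; first by exists x; left.
  by move=> [] /= ?; subst m; [left|right]; apply: mmin; [right|left].
have tr x y z : R x y -> R y z -> R x z.
  move=> Rxy Ryz; have [|m mX mmin] := minR [set x; y; z].
    by exists x; left; left.
  have [Rmx Rmy Rmz] : [/\ R m x, R m y & R m z].
    by split; apply: mmin; [left; left|left; right|right].
  case: mX => [[]|] /= ?; subst m => //.
    by rewrite (@min2 x y).
  by rewrite -(@min2 y z).
pose sR x y := R x y /\ x <> y.
have sR_irr x : ~ sR x x by move=> [].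
have sR_trans x y z : sR x y -> sR y z -> sR x z.
  move=> [xy nxy] [yz nyz]; split; first exact: tr yz.
  by move=> xz; subst z; apply: nxy; exact: min2.
have sR_total x y : x <> y -> sR x y \/ sR y x.
  move=> xy; have [|] := tot x y; [left|right] => //; split=> //.
  by move=> yx; apply: xy.
exists sR, (And3 sR_irr sR_trans sR_total) => X /minR[m Xm mmin].
exists m => // x Xx [xm]; apply; apply: min2; split=> //; exact: mmin.
Qed.

Definition wo (T : Type) : linorder := Linorder (tag (tagged (well_ordering_strict T))).

Lemma wo_wellordered T : wellordered (wo T).
Proof. exact: tagged (tagged (well_ordering_strict T)). Qed.

(* Comparability of well-orders: either [X] injects into [R], or the ordinal
   of [R] is enumerated by an initial part of [X]. *)
Lemma wellordered_compare (A B : linorder) (R : set A) (X : set B) :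
    wellordered A -> wellordered B -> A -> X !=set0 ->
  (exists2 i : B -> A, (forall b, X b -> R (i b)) &
     forall b c, X b -> X c -> i b = i c -> b = c) \/
  (exists e : A -> B, [/\ forall x, X (e x),
    forall x y, R y -> before y x -> e y <> e x
    & forall x b, X b -> before b (e x) -> exists y, [/\ R y, before y x & e y = b]]).
Proof.
move=> woA woB a0 [b0 Xb0].
pose least x (g : forall y, before y x -> B) m :=
  [/\ X m, forall y (yx : before y x), R y -> g y yx <> m
    & forall b, X b -> before b m -> exists y (yx : before y x), R y /\ g y yx = b].
pose F x (g : forall y, before y x -> B) : B :=
  xget (b0 : {classic B}) [set m : {classic B} | least x g m].
have F_ext x (g h : forall y, before y x -> B) :
    (forall y yx, g y yx = h y yx) -> F x g = F x h.
  move=> gh; congr F; apply: functional_extensionality_dep => y.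
  by apply: functional_extensionality_dep => yx; exact: gh.
pose e := Fix (wellordered_wf woA) (fun=> B) F.
have eE x : e x = F x (fun y _ => e y).
  exact: (@Fix_eq A _ (wellordered_wf woA) (fun=> B) F F_ext).
(* If all of [X] is used up at some stage [x], choosing preimages injects [X] into [R]; otherwise
   the default [b0] is never taken. *)
have [[x xP]|nx] := pselect (exists x, forall b, X b ->
    exists y, [/\ R y, before y x & e y = b]).
  left; have /choice[i iP] b : exists y, X b -> R y /\ e y = b.
    by have [/xP[y [? _ ?]]|nXb] := EM (X b); [exists y | exists a0].
  exists i => [b /iP[]//|b c /iP[_ {2}<-] /iP[_ {2}<-] ->//].
right; exists e.
suff eP x : least x (fun y _ => e y) (e x).
  split=> [x|x y Ry yx|x b Xb bx].
  - by have [] := eP x.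
  - by have [_ /(_ y yx Ry)] := eP x.
  - by have [_ _ /(_ b Xb bx)[y [yx [Ry <-]]]] := eP x; exists y.
rewrite eE; apply: (@xgetPex {classic B} b0).
have [|m [Xm nm] mmin] := woB [set b | X b /\ forall y, R y -> before y x -> e y <> b].
  apply: contrapT => nb; apply: nx; exists x => b Xb; apply: contrapT => ny.
  by apply: nb; exists b; split=> // y Ry yx yb; apply: ny; exists y.
exists m; split=> // [y yx Ry|b Xb bm]; first exact: nm.
apply: contrapT => ny; apply: (mmin b _ bm); split=> // y Ry yx yb.
by apply: ny; exists y, yx.
Qed.

(** * Scattered orders and sums *)

Section Scattered.
Variable K : Type.

Definition dense_in (A : linorder) (Q : set A) :=
  (exists a b, [/\ Q a, Q b & before a b]) /\
  forall a b, Q a -> Q b -> before a b ->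
    [set: K] #<= [set x | [/\ Q x, before a x & before x b]].

Definition scattered (A : linorder) := forall Q : set A, ~ dense_in Q.

(** Between [a] and its successor in [Q] there would be a further point of [Q], since [k0] makes the
    interval nonempty. *)
Lemma wellordered_scattered (A : linorder) : K -> wellordered A -> scattered A.
Proof.
move=> k0 woA Q [[a [b [Qa Qb ab]]] Qd].
have [|m [Qm am] mmin] := woA [set x | Q x /\ before a x]; first by exists b.
have /card_leTP[g _ /(_ k0)[Qx ax xm]] := Qd a m Qa Qm am.
exact: (mmin (g k0)).
Qed.

Lemma rev_before_strict_total (A : linorder) : strict_total (fun x y : A => before y x).
Proof.
split=> [|x y z yx zy|x y xy]; [exact: before_irr | exact: before_trans zy yx |].
by have [] := before_total xy; [right|left].
Qed.

Definition rev_order (A : linorder) : linorder := Linorder (rev_before_strict_total A).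

Lemma rev_scattered (A : linorder) : scattered A -> scattered (rev_order A).
Proof.
move=> sA Q [[a [b [Qa Qb ab]]] Qd]; apply: (sA Q); split; first by exists b, a.
move=> c d Qc Qd' cd; apply: (card_le_trans (Qd d c Qd' Qc cd)).
by apply: subset_card_le => x [].
Qed.

Definition sum_before (I : linorder) (B : I -> linorder) (p q : {i : I & B i}) :=
  before (tag p) (tag q) \/
  exists e : tag p = tag q, before (eq_rect _ B (tagged p) _ e) (tagged q).

Lemma sum_before_fibre (I : linorder) (B : I -> linorder) i (x y : B i) :
  sum_before (Tagged B x) (Tagged B y) <-> before x y.
Proof.
split=> [[/before_irr//|[e]]|xy]; last by right; exists erefl.
by rewrite (Prop_irrelevance e erefl).
Qed.

Lemma sum_beforeP (I : linorder) (B : I -> linorder) (p q : {i : I & B i}) :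
  sum_before p q -> before (tag p) (tag q) \/ tag p = tag q.
Proof. by case=> [|[]]; [left|right]. Qed.

Lemma sum_before_strict_total (I : linorder) (B : I -> linorder) :
  strict_total (@sum_before I B).
Proof.
split=> [[i x] /sum_before_fibre/before_irr//|[i x] [j y] [k z]|[i x] [j y] xy].
  move=> [ij|[/= e xy]] [jk|[/= f yz]].
  - by left; exact: before_trans jk.
  - by left; subst k.
  - by left; subst j.
  - by subst j k; apply/sum_before_fibre; exact: before_trans yz.
have [ij|/before_total[]] := EM (i = j); last 2 first.
- by left; left.
- by right; left.
subst j; have [|yx|yx] := @before_total _ x y; first by move=> yx; subst y.
- by left; apply/sum_before_fibre.
- by right; apply/sum_before_fibre.
Qed.

Definition sum_order (I : linorder) (B : I -> linorder) : linorder :=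
  Linorder (@sum_before_strict_total I B).

Definition prod_order (A B : linorder) := sum_order (fun _ : A => B).

(* Two points of a dense suborder in one fibre make that fibre dense;
   otherwise the suborder projects injectively to the index. *)
Lemma sum_scattered (I : linorder) (B : I -> linorder) :
  scattered I -> (forall i, scattered (B i)) -> scattered (sum_order B).
Proof.
move=> sI sB Q [[a [b [Qa Qb ab]]] Qd].
have btw (i : I) (c d p : sum_order B) : tag c = i -> tag d = i ->
    before c p -> before p d -> tag p = i.
  move=> ci di /sum_beforeP[|<-//] cp /sum_beforeP[|->//] pd; subst i.
  by have := before_trans cp pd; rewrite di => /before_irr.
have [[i [x [y [Qx Qy xy]]]]|ninj] := pselect (exists i (x y : B i),
    [/\ Q (Tagged B x), Q (Tagged B y) & before x y]).
  apply: (sB i [set x | Q (Tagged B x)]); split; first by exists x, y.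
  move=> c d Qc Qd' cd.
  have /card_leTP[g ginj gP] := Qd _ _ Qc Qd' ((sum_before_fibre _ _).2 cd).
  have /choice[h hP] k : exists z : B i, g k = Tagged B z.
    have [_ cg gd] := gP k; have := btw i (existT _ i c) (existT _ i d) (g k) erefl erefl cg gd.
    by case: (g k) => j z /= ji; subst j; exists z.
  apply/card_leTP; exists h => [k k' hk|k].
    by apply: ginj; rewrite !hP hk.
  by have [] := gP k; rewrite hP => ? /sum_before_fibre ? /sum_before_fibre.
have inj p q : Q p -> Q q -> before p q -> before (tag p) (tag q).
  move=> Qp Qq pq; have [//|e] := sum_beforeP pq; case: ninj.
  case: p q e Qp Qq pq => i x [j y] /= e; subst j => Qx Qy /sum_before_fibre xy.
  by exists i, x, y.
apply: (sI [set tag p | p in Q]); split.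
  by exists (tag a), (tag b); split; [exists a|exists b|exact: inj].
move=> _ _ [c Qc <-] [d Qd' <-] cd.
have /card_leTP[g ginj gP] := Qd _ _ Qc Qd' (or_introl cd).
apply/card_leTP; exists (fun k => tag (g k)) => [k k' gk|k /=]; last first.
  by have [Qg cg gd] := gP k; split; [exists (g k)|exact: inj..].
apply: ginj; apply: contrapT => /(@before_total (sum_order B)).
have [[Qg _ _] [Qg' _ _]] := (gP k, gP k').
by case=> [/(inj _ _ Qg Qg')|/(inj _ _ Qg' Qg)]; rewrite gk => /before_irr.
Qed.

End Scattered.

(** * Passage between [orderType] and [linorder] *)

Lemma order_strict_total d (P : orderType d) :
  strict_total (fun x y : P => (x < y)%O).
Proof.
split=> [x|x y z|x y /eqP]; rewrite ?ltxx//; first exact: lt_trans.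
by rewrite neq_lt => /orP.
Qed.

Definition of_order d (P : orderType d) : linorder :=
  Linorder (@order_strict_total d P).

Section OrderOfLinorder.
Variable A : linorder.

Definition order_of : Type := {classic A}.
HB.instance Definition _ := Choice.on order_of.

Let ltb (x y : order_of) := `[<@before A x y>].

Let ltb_irr : irreflexive ltb.
Proof. by move=> x; apply/asboolP/before_irr. Qed.

Let ltb_trans : transitive ltb.
Proof. by move=> y x z /asboolP xy /asboolP yz; apply/asboolP/(before_trans xy). Qed.

HB.instance Definition _ :=
  Order.Lt_isPOrder.Build (Order.Disp tt tt) order_of ltb_irr ltb_trans.

Let order_of_total : total (<=%O : rel order_of).
Proof.
move=> x y; rewrite !le_eqVlt; have [->|/eqP/(@before_total A)] := eqVneq x y; first by [].
by case=> xy; apply/orP; [left|right]; apply/orP; right; apply/asboolP.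
Qed.

HB.instance Definition _ :=
  Order.POrder_isTotal.Build (Order.Disp tt tt) order_of order_of_total.

Lemma lt_order_of (x y : order_of) : (x < y)%O <-> @before A x y.
Proof. by split=> /asboolP. Qed.

Lemma order_of_scattered kappa : scattered kappa A -> kscattered kappa order_of.
Proof.
move=> sA Q [nQ Qd]; apply: (sA Q); split.
  apply: contrapT => nab; apply: nQ => x y Qx Qy; apply: contrapT => /before_total.
  by move=> [] xy; apply: nab; [exists x, y|exists y, x].
move=> a b Qa Qb /lt_order_of/(Qd a b Qa Qb)/card_leTP[g ginj gP].
apply/card_leTP; exists g => // k; have [Qg /andP[ag gb]] := gP k.
by split=> //; apply/lt_order_of.
Qed.

End OrderOfLinorder.

(** * Cardinals with kappa^(<kappa) = kappa *)

Section WeakPower.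
Variable K : cardinal.
Hypothesis K_infinite : infinite_cardinal K.
Hypothesis K_weak_power : weak_power_self K.

Lemma infinite_nleq_bool (X : set bool) : ~ ([set: K] #<= X).
Proof. by move=> /card_le_finite/(_ finite_finset). Qed.

Lemma infinite_pair : exists k0 k1 : K, k0 <> k1.
Proof.
move/infiniteP: K_infinite => /card_leTP[f finj _].
by exists (f 0%N), (f 1%N) => /finj.
Qed.

Lemma lt_cardinal_power (mu : cardinal) : [set: mu] #<= [set: K] ->
  ~ ([set: K] #<= [set: mu]) -> exists f : (mu -> K) -> K, injective f.
Proof.
move=> muK nKmu; have /K_weak_power.1/card_leTP[f finj _] : lt_cardinal mu K.
  by split=> //; apply/negP; rewrite card_eq_le => /andP[_ /nKmu].
by exists f.
Qed.

(** The square of [K] is [K ^ bool], and [bool] is smaller than the infinite [K]. *)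
Lemma square_inj : exists p : K -> K -> K,
  forall x y x' y', p x y = p x' y' -> x = x' /\ y = y'.
Proof.
have [k0 [k1 k01]] := infinite_pair.
have [||f finj] := @lt_cardinal_power bool.
- apply/card_leTP; exists (fun b : bool => if b then k0 else k1) => // -[] [] //.
  by move=> /esym.
- exact: infinite_nleq_bool.
exists (fun x y => f (fun b => if b then x else y)) => x y x' y' /finj fE.
by split; [have := congr1 (@^~ true) fE | have := congr1 (@^~ false) fE].
Qed.

Lemma seq_inj (W : Type) : [set: W] #<= [set: K] -> [set: seq W] #<= [set: K].
Proof.
move=> /card_leTP[w winj _]; have [p pinj] := square_inj.
have [k0 [k1 k01]] := infinite_pair.
pose code := fix code (s : seq W) :=
  if s is x :: s' then p k1 (p (w x) (code s')) else p k0 k0.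
apply/card_leTP; exists code => // s; elim: s => [|x s IHs] [|y t] //=.
- by move=> /pinj[].
- by move=> /pinj[/esym].
- by move=> /pinj[_ /pinj[/winj-> /IHs->]].
Qed.

Let O := wo K.
Let init (a : O) : set O := [set b | before b a].

(** Code each row of the relation by a point of [K], then the family of rows. *)
Lemma relations_inj (a : O) : ~ ([set: K] #<= init a) ->
  exists f : (init a -> init a -> Prop) -> K, injective f.
Proof.
move=> na; have [k0 [k1 k01]] := infinite_pair.
have [||f finj] := @lt_cardinal_power (init a).
- by apply/card_leTP; exists val => //; exact: val_inj.
- move=> /card_leTP[g ginj _]; apply: na; apply/card_leTP.
  exists (val \o g) => [x y /val_inj/ginj//|x]; exact: set_valP.
exists (fun r => f (fun b => f (fun c => if `[< r b c >] then k0 else k1))).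
move=> r r' /finj E; apply: funext => b; apply: funext => c.
have /finj/(congr1 (@^~ c)) := congr1 (@^~ b) E.
case: asboolP => h; case: asboolP => h' E'; apply: propext; split=> // _; exfalso;
  by move: k01; rewrite E'.
Qed.

(* The sum of all linear orders on proper initial segments of [K] that have
   fewer than [K] elements. *)
Lemma universal_small_order : exists W : linorder,
  [/\ scattered K W, [set: W] #<= [set: K] & forall (P : linorder) (R : set P),
    ~ ([set: K] #<= R) -> exists e : P -> W, mono_on R e].
Proof.
pose D := {ar : {a : O & init a -> init a -> Prop} |
  ~ ([set: K] #<= init (tag ar)) /\ strict_total (tagged ar)}.
pose L (d : wo D) := Linorder (svalP d).2.
exists (sum_order L); split.
- apply: sum_scattered.
    by have [k0 _] := infinite_pair; exact: wellordered_scattered k0 (@wo_wellordered D).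
  move=> [[a r] [na rs]] Q [[b [c [Qb Qc bc]]] Qd].
  have /card_leTP[g ginj _] := Qd b c Qb Qc bc.
  apply: (na); apply/card_leTP.
  exists (val \o g) => [x y /val_inj/ginj//|x]; exact: set_valP.
- have [p pinj] := square_inj.
  have /all_sig[code codeP] a : {f : (init a -> init a -> Prop) -> K |
      ~ ([set: K] #<= init a) -> injective f}.
    apply: cid; have [Ka|/relations_inj[f finj]] := EM ([set: K] #<= init a).
      by exists (fun=> a).
    by exists f.
  apply/card_leTP; exists (fun w : sum_order L =>
    let d := sval (tag w) in
    p (tag d : K) (p (code (tag d) (tagged d)) (val (tagged w : init (tag d))))) => //.
  move=> [[[a r] [/= na rs]] x] [[[a' r'] [/= na' rs']] x'] /= /pinj[aa'].
  subst a'; move=> /pinj[/(codeP a na) rr' /val_inj xx']; subst r' x'.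
  by rewrite (Prop_irrelevance na na') (Prop_irrelevance rs rs').
pose claim (P : linorder) (R : set P) := exists e : P -> sum_order L, mono_on R e.
have small (P : linorder) (R : set P) : R !=set0 -> ~ ([set: K] #<= R) -> claim P R.
  move=> [x1 Rx1] nR.
  have [k0 _] := infinite_pair.
  (* No injection of [K] into [R] exists, so [e] enumerates [R] injectively by an initial part of
     [K]. *)
  have [[i iR iinj]|[e [_ einj einit]]] := @wellordered_compare
      (wo P) O R setT (@wo_wellordered P) (@wo_wellordered K) x1 (ex_intro _ k0 I).
    by exfalso; apply: nR; apply/card_leTP; exists i => [x y|x]; [exact: iinj|exact: iR].
  have {}einj x y : R x -> R y -> e x = e y -> x = y.
    move=> Rx Ry exy; apply: contrapT => /(@before_total (wo P))[] xy.
      exact: einj Rx xy exy.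
    exact: einj Ry xy (esym exy).
  have ninv (X : set O) : (forall b, X b -> exists2 y, R y & e y = b) ->
      ~ ([set: K] #<= X).
    move=> Xe KX; apply/nR/(card_le_trans KX).
    apply: (card_le_trans _ (card_image_le e R)); apply: subset_card_le => b.
    by move=> /Xe.
  (* The image of [R] is the segment below its first missing value [a]; the order of [R] is
     transported to that segment. *)
  have [|a na amin] := @wo_wellordered K [set b | forall y, R y -> e y <> b].
    apply: contrapT => n; apply: (ninv setT) (card_lexx _) => b _.
    by apply: contrapT => nb; apply: n; exists b => y Ry yb; apply: nb; exists y.
  have ea y : R y -> before (e y) a.
    move=> Ry; apply: contrapT => /not_before[/(na y Ry)//|].
    by move=> /(einit _ _ I)[z [Rz _ /(na z Rz)]].
  have /choice[inv invP] (b : init a) : exists y, R y /\ e y = val b.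
    apply: contrapT => nb; apply: (amin (val b) _ (set_valP b)).
    by move=> y Ry yb; apply: nb; exists y.
  have rs : strict_total (fun b c => before (inv b) (inv c)).
    split=> [x|x y z|x y xy]; [exact: before_irr|exact: before_trans|].
    apply: before_total => ixy; apply: xy; apply: val_inj.
    by rewrite -(invP x).2 ixy (invP y).2.
  have na' : ~ ([set: K] #<= init a).
    apply: ninv => b ba; have [Ry yb] := invP (SigSub (mem_set (ba : init a b))).
    by exists (inv (SigSub (mem_set (ba : init a b)))).
  pose d : D := exist _ (existT _ a (fun b c => before (inv b) (inv c))) (conj na' rs).
  have /choice[E EP] x : exists w : L d, R x -> val (w : init a) = e x.
    have [Rx|nRx] := EM (R x); first by exists (SigSub (mem_set (ea x Rx : init a _))).
    by exists (SigSub (mem_set (ea _ Rx1 : init a _))).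
  exists (fun x => Tagged L (E x : L d)) => x y Rx Ry xy; apply/sum_before_fibre => /=.
  have invE z : R z -> inv (E z) = z.
    by move=> Rz; have [Ri] := invP (E z); rewrite EP// => /einj; apply.
  by rewrite !invE.
(* For empty [R] any map into [W] serves; a point of [W] comes from embedding a two-element
   order. *)
move=> P R nR; have [/small|R0] := EM (R !=set0); first by apply.
have [||e _] := @small (wo bool) setT; first by exists true.
  exact: infinite_nleq_bool.
by exists (fun=> e true) => x y Rx; case: R0; exists x.
Qed.

End WeakPower.

(** * Decomposition of scattered orders *)

Section Decomposable.
Variables (d : Order.disp_t) (P : orderType d) (J : linorder).

Definition weakly_mono (A : linorder) (Q : set P) (g : P -> A) :=
  forall x y, Q x -> Q y -> (x < y)%O -> g x = g y \/ before (g x) (g y).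

(** Empty fibres are harmless, being subsingletons, so [g] may miss points of [J]. *)
Inductive decomposable : set P -> Prop :=
| decomposable1 Q : is_subset1 Q -> decomposable Q
| decomposable_sum Q (g : P -> J) : weakly_mono Q g ->
    (forall j, decomposable (Q `&` [set x | g x = j])) -> decomposable Q.

Lemma decomposable_sub (Q Q' : set P) :
  decomposable Q -> Q' `<=` Q -> decomposable Q'.
Proof.
move=> dQ; elim: dQ Q' => {Q} [Q Q1|Q g gmono _ IH] Q' QQ'.
  by apply: decomposable1 => x y /QQ' Qx /QQ'; exact: Q1.
apply: (decomposable_sum (g := g)) => [x y /QQ' Qx /QQ'|j]; first exact: gmono.
by apply: (IH j) => x [/QQ' Qx gx].
Qed.

(** Compose [g] with [e]: as [e] is injective on [S], every nonempty fibre of [e \o g] on [Q] lies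
    in one fibre of [g]. *)
Lemma decomposable_sum_along (I : linorder) (S : set I) (e : I -> J)
    (Q : set P) (g : P -> I) :
    mono_on S e -> (forall x, Q x -> S (g x)) -> weakly_mono Q g ->
    (forall i, S i -> decomposable (Q `&` [set x | g x = i])) ->
  decomposable Q.
Proof.
move=> emono gS gmono dg; apply: (decomposable_sum (g := e \o g)) => [x y Qx Qy xy|j].
  have [gxy|gxy] := gmono x y Qx Qy xy; first by left; rewrite /= gxy.
  by right; apply: emono => //; exact: gS.
have [[x [Qx xj]]|Q0] := EM (Q `&` [set x | (e \o g) x = j] !=set0); last first.
  by apply: decomposable1 => x y Qx; case: Q0; exists x.
apply: (decomposable_sub (dg (g x) (gS x Qx))) => y [Qy yj]; split=> //=.
apply: contrapT => /before_total[] /emono => /(_ (gS _ _) (gS _ _)).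
  by move=> /(_ Qy Qx); rewrite -[e (g y)]/((e \o g) y) yj -xj => /before_irr.
by move=> /(_ Qx Qy); rewrite -[e (g x)]/((e \o g) x) xj -yj => /before_irr.
Qed.

Variable K : cardinal.
Hypothesis K_infinite : infinite_cardinal K.
Hypothesis J_small : forall (I : linorder) (S : set I), ~ ([set: K] #<= S) ->
  exists e : I -> J, mono_on S e.
Hypothesis J_wo : exists e : wo P -> J, mono_on setT e.
Hypothesis J_rev_wo : exists e : rev_order (wo P) -> J, mono_on setT e.

(** A sum along the two-element order [bool], which embeds in [J] because [K] is infinite. *)
Lemma decomposableU (Q1 Q2 : set P) : decomposable Q1 -> decomposable Q2 ->
  (forall x y, Q1 x -> Q2 y -> (x < y)%O) -> decomposable (Q1 `|` Q2).
Proof.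
move=> dQ1 dQ2 Q12; have Q2n x : Q1 x -> Q2 x -> False.
  by move=> Q1x /(Q12 x x Q1x); rewrite ltxx.
have [e emono] : exists e : of_order bool -> J, mono_on setT e.
  by apply: J_small; exact: infinite_nleq_bool.
apply: (decomposable_sum_along (g := fun x => `[<Q2 x>] : of_order bool) emono) => //.
  move=> x y [Q1x|Q2x] [Q1y|Q2y] xy.
  - by left; rewrite !asboolF//; exact: Q2n.
  - by right; rewrite [`[<Q2 x>]]asboolF ?[`[<Q2 y>]]asboolT//; exact: Q2n.
  - by have := Q12 y x Q1y Q2x; rewrite lt_gtF.
  - by left; rewrite !asboolT.
case=> _; [apply: (decomposable_sub dQ2)|apply: (decomposable_sub dQ1)].
  by move=> x [_ /asboolP].
by move=> x [[//|Q2x] /=]; rewrite asboolT.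
Qed.

Lemma decomposable_split (a : P) (Q : set P) :
  decomposable (Q `&` [set x | x < a]%O) -> decomposable (Q `&` [set x | a <= x]%O) ->
  decomposable Q.
Proof.
move=> lo hi; apply: (decomposable_sub (decomposableU lo hi _)).
  by move=> x y [_ /= xa] [_ /=]; exact: lt_le_trans.
by move=> x Qx; have [xa|ax] := ltP x a; [left|right].
Qed.

Definition segment (x y : P) : set P :=
  [set z | (Order.min x y <= z <= Order.max x y)%O].

Definition close x y := decomposable (segment x y).

Lemma close_sub x y z w : close x y -> segment x y z -> segment x y w -> close z w.
Proof.
move=> xy /andP[xz zy] /andP[xw wy]; apply: (decomposable_sub xy) => v /andP[zv vw].
apply/andP; split; first by apply: le_trans zv; rewrite le_min xz.
by apply: (le_trans vw); rewrite ge_max zy.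
Qed.

Lemma segment_left x y : segment x y x.
Proof. by rewrite /segment /= ge_min le_max lexx. Qed.

Lemma segment_right x y : segment x y y.
Proof. by rewrite /segment /= ge_min le_max lexx !orbT. Qed.

Lemma closexx x : close x x.
Proof.
apply: decomposable1 => y z; rewrite /segment /= minxx maxxx.
by rewrite -!eq_le => /eqP<- /eqP<-.
Qed.

Lemma close_sym x y : close x y -> close y x.
Proof. by move=> xy; apply: (close_sub xy); [exact: segment_right|exact: segment_left]. Qed.

(** Cut the segment from [x] to [z] at [y]: each half lies in one of the two given segments,
    whatever the order of the three points. *)
Lemma close_trans y x z : close x y -> close y z -> close x z.
Proof.
move=> xy yz; apply: (@decomposable_split y).
  have [xz|zx] := leP x z.
    apply: (decomposable_sub xy) => w [/andP[+ _] /= wy]; rewrite min_l// => xw.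
    by rewrite /segment /= ge_min xw le_max (ltW wy) orbT.
  apply: (decomposable_sub yz) => w [/andP[+ _] /= wy]; rewrite (min_r (ltW zx)) => zw.
  by rewrite /segment /= ge_min zw le_max (ltW wy) !orbT.
have [xz|zx] := leP x z.
  apply: (decomposable_sub yz) => w [/andP[_ +] /= yw]; rewrite max_r// => wz.
  by rewrite /segment /= ge_min yw le_max wz orbT.
apply: (decomposable_sub xy) => w [/andP[_ +] /= yw]; rewrite (max_l (ltW zx)) => wx.
by rewrite /segment /= ge_min yw le_max wx !orbT.
Qed.

(** Above [a], send [y] to the first [z >= y] of the class in a well-order of [P]. This map is
    weakly increasing and its fibre over [z] lies in the segment from [a] to [z], so the upper half
    is a sum along a well-order. Below [a], the first [z <= y] gives a sum along the reversed
    well-order. *)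
Lemma decomposable_class a : decomposable [set x | close a x].
Proof.
apply: (@decomposable_split a).
  pose U := [set x | close a x /\ (x < a)%O].
  have /choice[g gP] y : exists z, U y -> [/\ U z, (z <= y)%O
      & forall z', U z' -> (z' <= y)%O -> ~ @before (wo P) z' z].
    have [Uy|nU] := EM (U y); last by exists y.
    have [|z [Uz zy] zmin] := @wo_wellordered P [set z | U z /\ (z <= y)%O].
      by exists y.
    by exists z => _; split=> // z' Uz' z'y; exact: zmin.
  have [e emono] := J_rev_wo.
  apply: (@decomposable_sum_along (rev_order (wo P)) U e _ g).
  - by move=> x y _ _; exact: (emono x y).
  - by move=> y /gP[].
  - move=> x y Ux Uy xy; have [Ugx gx gxmin] := gP x Ux.
    have [Ugy gy gymin] := gP y Uy.
    have /not_before[|] := gymin _ Ugx (le_trans gx (ltW xy)); [by left|].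
    by right.
  move=> z [az za]; apply: (decomposable_sub az) => y [Uy /= gyz].
  have [_ zy _] := gP y Uy; rewrite gyz in zy.
  by rewrite /segment /= (min_r (ltW za)) (max_l (ltW za)) zy ltW//; case: Uy.
pose U := [set x | close a x /\ (a <= x)%O].
have /choice[g gP] y : exists z, U y -> [/\ U z, (y <= z)%O
    & forall z', U z' -> (y <= z')%O -> ~ @before (wo P) z' z].
  have [Uy|nU] := EM (U y); last by exists y.
  have [|z [Uz zy] zmin] := @wo_wellordered P [set z | U z /\ (y <= z)%O].
    by exists y.
  by exists z => _; split=> // z' Uz' z'y; exact: zmin.
have [e emono] := J_wo.
apply: (@decomposable_sum_along (wo P) U e _ g).
- by move=> x y _ _; exact: (emono x y).
- by move=> y /gP[].
- move=> x y Ux Uy xy; have [Ugx gx gxmin] := gP x Ux.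
  have [Ugy gy gymin] := gP y Uy.
  have /not_before[|] := gxmin _ Ugy (le_trans (ltW xy) gy); [by left|].
  by right.
move=> z [az za]; apply: (decomposable_sub az) => y [Uy /= gyz].
have [_ yz _] := gP y Uy; rewrite gyz in yz.
by rewrite /segment /= min_l ?max_r// yz andbT; case: Uy.
Qed.

Lemma scattered_decomposable : kscattered K P -> decomposable setT.
Proof.
move=> sP; have [[p0]|nP] := pselect $|P|; last first.
  by apply: decomposable1 => x; case: nP.
suff close0 x : close p0 x.
  by apply: (decomposable_sub (decomposable_class p0)) => x _; exact: close0.
apply: contrapT => n0x.
(* [xget] depends only on the class as a set, so close points get equal representatives. *)
pose rep x := xget p0 [set y | close x y].
have close_rep y : close y (rep y).
  by apply: (@xgetPex _ p0 [set z | close y z]); exists y; exact: closexx.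
have rep_eq y z : close y z -> rep y = rep z.
  move=> yz; congr xget; apply/seteqP; split=> w /=; last exact: close_trans yz.
  exact: close_trans (close_sym yz).
have repK y : rep (rep y) = rep y by apply/esym/rep_eq.
have rep_close y z : rep y = rep z -> close y z.
  by move=> yz; apply: (close_trans (close_rep y)); rewrite yz; exact/close_sym.
have rep_mono y z : (y < z)%O -> (rep y <= rep z)%O.
  move=> yz; rewrite leNgt; apply/negP => ryz.
  suff yz' : close y z by move: ryz; rewrite (rep_eq _ _ yz') ltxx.
  (* Either [rep z <= y < z], so [y] lies in the segment of [z] and [rep z], or [y < rep z < rep y],
     so [y] is close to [rep z]. *)
  have [rzy|yrz] := leP (rep z) y.
    apply: (close_sub (close_sym (close_rep z))); last exact: segment_right.
    by rewrite /segment /= ge_min rzy le_max (ltW yz) orbT.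
  apply: (@close_trans (rep z)); last exact/close_sym.
  apply: (close_sub (close_rep y)); first exact: segment_left.
  by rewrite /segment /= ge_min (ltW yrz) le_max (ltW ryz) orbT.
apply: (sP (range rep)); split.
  move=> /(_ (rep p0) (rep x)) r; apply: n0x; apply: rep_close; apply: r.
    by exists p0.
  by exists x.
move=> _ _ [p' _ <-] [q' _ <-]; set p := rep p'; set q := rep q' => pq.
apply: contrapT; set S := [set _ | _] => nS.
have [e emono] := @J_small (of_order P) S nS.
(* With fewer than [K] representatives strictly between [p] and [q], the segment consists of a part
   of one class, a sum of parts of classes along [S], and a part of a last class. *)
have pqclose : close p q.
  rewrite /close; have segE y : segment p q y -> (p <= y <= q)%O.
    by rewrite /segment /= (min_l (ltW pq)) (max_r (ltW pq)).
  have fibre z : decomposable (segment p q `&` [set y | rep y = z]).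
    apply: (decomposable_sub (decomposable_class z)) => y [_ /= <-].
    exact/close_sym.
  have rep_lt y z : (rep y < rep z)%O -> (y < z)%O.
    rewrite !ltNge; apply: contra; rewrite le_eqVlt => /orP[/eqP->//|].
    exact: rep_mono.
  have mid : decomposable (segment p q `&` [set y | S (rep y)]).
    apply: (@decomposable_sum_along (of_order P) S e _ rep emono).
    - by move=> y [].
    - move=> y z _ _ /rep_mono; rewrite le_eqVlt => /orP[/eqP|]; by [left|right].
    - move=> z _; apply: (decomposable_sub (fibre z)) => y [[? _]]; exact.
  have left : decomposable (segment p q `&` [set y | rep y = p]
      `|` segment p q `&` [set y | S (rep y)]).
    apply: (decomposableU (fibre p) mid) => y z [_ /= yp] [_ [_ /andP[pz _]]].
    by apply: rep_lt; rewrite yp.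
  apply: (decomposable_sub (decomposableU left (fibre q) _)).
    move=> y z yS [_ /= zq]; apply: rep_lt; rewrite zq.
    by case: yS => [[_ /= ->//]|[_ [_ /andP[]]]].
  have rpE : rep p = p by exact: repK.
  have rqE : rep q = q by exact: repK.
  move=> y ys; have /andP[py yq] := segE y ys.
  move: py; rewrite le_eqVlt => /orP[/eqP<-|/rep_mono py].
    by left; left; split=> //; exact: segment_left.
  move: yq; rewrite le_eqVlt => /orP[/eqP->|/rep_mono yq].
    by right; split=> //; exact: segment_right.
  rewrite rpE in py; rewrite rqE in yq.
  move: py; rewrite le_eqVlt => /orP[/eqP py|py]; first by left; left.
  move: yq; rewrite le_eqVlt => /orP[/eqP yq|yq]; first by right.
  by left; right; split=> //; split; [exists y|apply/andP].
by have := rep_eq _ _ pqclose; rewrite !repK -/p -/q => r; move: pq; rewrite r ltxx.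
Qed.

End Decomposable.

(** * Colourings *)

Section Homogeneous.
Variable C : Type.

(** The partition relation $N \to (L)^1_C$. *)
Definition homogeneous (N L : linorder) := forall chi : N -> C,
  exists (e : L -> N) (c : C), mono_on setT e /\ forall x, chi (e x) = c.

Lemma homogeneous_rev N L : homogeneous N L ->
  homogeneous (rev_order N) (rev_order L).
Proof.
move=> hom chi; have [e [c [emono ec]]] := hom chi; exists e, c; split=> //.
by move=> x y _ _; exact: emono.
Qed.

(** First find a homogeneous copy of [L'] in each column, then use homogeneity of [N] for the
    resulting colours of columns. *)
Lemma homogeneous_prod (N L N' L' : linorder) : homogeneous N L ->
  homogeneous N' L' ->
  homogeneous (prod_order N N') (prod_order L L').
Proof.
move=> hom hom' chi.
have /choice[e' /choice[c' e'P]] x := hom' (fun y => chi (existT (fun=> car N') x y)).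
have [e [c [emono ec]]] := hom c'.
exists (fun p => existT (fun=> car N') (e (tag p)) (e' (e (tag p)) (tagged p))), c.
split; last first.
  by move=> [x y]; rewrite (e'P _).2 ec.
move=> [x y] [x' y'] _ _ [/= xx'|[/= xx' yy']]; first by left; exact: emono.
by subst x'; apply/sum_before_fibre; exact: (e'P _).1.
Qed.

(* [set (C * T)] has too many elements to be covered by [C] many fibres that
   inject into [T]. *)
Lemma homogeneous_wo (T : Type) (t0 : T) :
  homogeneous (wo (set (C * T))) (wo T).
Proof.
move=> chi; apply: contrapT => nhom.
(* Without a homogeneous copy of [wo T], comparison makes every colour class inject into [T]. *)
have /choice[i iP] c : exists i : set (C * T) -> T,
    forall X Y, chi X = c -> chi Y = c -> i X = i Y -> X = Y.
  have [nX|X0] := EM ([set X | chi X = c] !=set0); last first.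
    by exists (fun=> t0) => X Y Xc; case: X0; exists X.
  have [[i _ iinj]|[e [eX einj einit]]] := @wellordered_compare (wo T)
      (wo (set (C * T))) setT [set X | chi X = c] (@wo_wellordered _)
      (@wo_wellordered _) t0 nX.
    by exists i => X Y; exact: iinj.
  case: nhom; exists e, c; split=> // x y _ _ xy.
  apply: contrapT => /not_before[|yx]; first exact: (einj y x I xy).
  have [z [_ zx zy]] := einit x (e y) (eX y) yx.
  exact: (einj y z I (before_trans zx xy) zy).
pose code X := (chi X, i (chi X) X).
have code_inj X Y : code X = code Y -> X = Y.
  by move=> [XY]; rewrite -XY => /iP; apply.
(* Cantor's diagonal set, against the injection [code] of [set (C * T)] into [C * T]. *)
pose D : set (C * T) := [set u | exists2 X, u = code X & ~ X u].
have [Du|nDu] := EM (D (code D)); last by apply: (nDu); exists D.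
by case: (Du) => X /code_inj <-; apply.
Qed.

End Homogeneous.

(** * Unavoidable requirements and their refinement *)

Section Colouring.
Variables (d : Order.disp_t) (phi : orderType d) (nu K : Type) (k0 : K).
Variables (J : linorder) (j0 : J) (W : Type) (w : J -> W).
Hypothesis w_surj : forall v, exists j, w j = v.
(** Meant for [J] a product of [W] with two further orders and [w] the projection to [W]. *)
Hypothesis J_arrow : forall C : Type, exists J' : linorder, scattered K J' /\
  forall chi : J' -> C, exists (e : J -> J') (tau : W -> C),
    mono_on setT e /\ forall j, chi (e j) = tau (w j).

(** The map [e] is total on [phi] but constrained on [Q] only, which avoids subtypes. *)
Definition embeds (Q : set phi) (B : linorder) (f : B -> nu) (c : set nu) :=
  exists e : phi -> B, (forall x y, Q x -> Q y -> (x < y)%O -> before (e x) (e y)) /\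
    forall x, Q x -> c (f (e x)).

(* A requirement [h] collects pairs of a colour set and a part of [phi] which
   is not to be embedded in these colours. *)
Definition realizes (h : set (set nu * set phi)) (B : linorder) (f : B -> nu) :=
  forall c Q, h (c, Q) -> ~ embeds Q f c.

Definition unavoidable h := forall B : linorder, B -> scattered K B ->
  exists f : B -> nu, realizes h f.

(** Demanding a part with two points is what contradicts the leaves of a decomposition in the
    end. *)
Definition refines (h : set (set nu * set phi))
    (F : W -> nu * set (set nu * set phi)) :=
  forall c Q (g : phi -> J), h (c, Q) -> (forall v, c (F v).1) -> weakly_mono Q g ->
  exists j, ~ is_subset1 (Q `&` [set x | g x = j]) /\
    (F (w j)).2 (c, Q `&` [set x | g x = j]).

Lemma unit_strict_total : strict_total (fun _ _ : unit => False).
Proof. by split=> // -[] []. Qed.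

Definition unit_order : linorder := Linorder unit_strict_total.

Lemma unit_scattered : scattered K unit_order.
Proof. by move=> Q [[? [? []]]]. Qed.

(** Suppose no [F] works. Each [F] that refines [h] then has a scattered [psi F] on which some
    [(F v).2] is not realized, and one scattered sum [Psi] contains all of these. A colouring of the
    product of [J'] and [Psi] that realizes [h] yields a [tau] that refines [h] and whose
    requirements are all realized on [psi tau], against the choice of [psi tau]. *)
Lemma unavoidable_refine h : unavoidable h ->
  exists F, refines h F /\ forall v, unavoidable (F v).2.
Proof.
move=> hh; apply: contrapT => nF.
have [f1 _] := hh unit_order tt unit_scattered.
pose Fam := wo (W -> nu * set (set nu * set phi)).
have /choice[psi psiP] (F : Fam) : exists psi : linorder, [/\ $|psi|, scattered K psi &
    refines h F -> exists v, forall f : psi -> nu, ~ realizes (F v).2 f].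
  have [Fh|nFh] := EM (refines h F); last first.
    by exists unit_order; split=> //; exact: unit_scattered.
  have : ~ forall v, unavoidable (F v).2 by move=> FU; apply: nF; exists F.
  move=> /existsNP[v /existsNP[B /existsNP[b /not_implyP[sB nB]]]].
  exists B; split=> //.
  by move=> _; exists v => f rf; apply: nB; exists f.
pose Psi := sum_order psi.
have sPsi : scattered K Psi.
  apply: sum_scattered => [|F]; last by have [] := psiP F.
  exact: wellordered_scattered k0 (@wo_wellordered _).
have [p0] : $|Psi|.
  have [[p _ _]] := psiP (fun=> (f1 tt, set0)).
  by squash (existT (fun F => car (psi F)) _ p).
have [J' [sJ' J'P]] := J_arrow (nu * set (set nu * set phi)).
have [e1 _] := J'P (fun=> (f1 tt, set0)).
pose at_ (j' : J') (y : Psi) : prod_order J' Psi :=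
  existT (fun=> car Psi) j' y.
have [f hf] := hh _ (at_ (e1 j0) p0) (sum_scattered sJ' (fun=> sPsi)).
(* Each copy of [Psi] is coloured by the pairs not embedded in it and by the colour of its point
   [p0]; the latter lets subsingleton parts embed at [p0]. *)
have [e [tau [emono etau]]] := J'P (fun j' => (f (at_ j' p0),
  [set cQ | ~ @embeds cQ.2 Psi (f \o at_ j') cQ.1])).
have [_ _ tauP] := psiP tau.
(* If every part embedded in its copy of [Psi], gluing along [e] would embed [Q], against [hf]. *)
have /tauP[v nv] : refines h tau.
  move=> c Q g hcQ ctau gmono; apply: contrapT => nj.
  have /choice[E EP] j : embeds (Q `&` [set x | g x = j]) (f \o at_ (e j)) c.
    have [Qj1|nQj] := EM (is_subset1 (Q `&` [set x | g x = j])).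
      exists (fun=> p0); split=> [x y Qx Qy|x _].
        by rewrite (Qj1 x y)// ltxx.
      by have := ctau (w j); rewrite -etau.
    apply: contrapT => nE; apply: nj; exists j; split=> //.
    by rewrite -etau.
  apply: (hf c Q hcQ); exists (fun x => at_ (e (g x)) (E (g x) x)).
  split=> [x y Qx Qy xy|x Qx]; last by apply: (EP (g x)).2.
  have [gxy|gxy] := gmono x y Qx Qy xy; last by left; exact: emono.
  rewrite gxy; apply/sum_before_fibre; apply: (EP (g y)).1 => //.
have [j wj] := w_surj v; subst v.
(* Restrict the colouring to the summand [psi tau] of the copy over [e j]: fewer pairs embed there
   than in the whole copy. *)
apply: (nv (fun y => f (at_ (e j) (existT (fun F => car (psi F)) tau y)))).
move=> c Q; rewrite -etau => nQ [E [Emono EP]]; apply: nQ.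
exists (fun x => existT (fun F => car (psi F)) tau (E x)); split=> // x y Qx Qy xy.
by apply/sum_before_fibre; exact: Emono.
Qed.

Lemma decomposable_arrow : [set: seq W] #<= [set: K] ->
    decomposable J [set: phi] -> ~ is_subset1 [set: phi] ->
  exists B : linorder, [/\ $|B|, scattered K B & forall f : B -> nu,
    exists c : set nu, c #<= [set: K] /\ embeds setT f c].
Proof.
move=> WK dphi nphi; apply: contrapT => nB.
pose h0 : set (set nu * set phi) := [set cQ | cQ.1 #<= [set: K] /\ cQ.2 = setT].
have uh0 : unavoidable h0.
  move=> B b sB; apply: contrapT => nf; apply: nB; exists B; split=> // f.
  apply: contrapT => nc; apply: nf; exists f => c Q [/= cK ->] fc.
  by apply: nc; exists c.
have /choice[ref refP] h : exists F, unavoidable h ->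
    refines h F /\ forall v, unavoidable (F v).2.
  have [/unavoidable_refine[F hF]|nh] := EM (unavoidable h); first by exists F.
  have [f _] := uh0 unit_order tt unit_scattered.
  by exists (fun=> (f tt, h)).
pose node := foldl (fun h v => (ref h v).2) h0.
have u_node s : unavoidable (node s).
  elim/last_ind: s => [//|s v IHs]; rewrite /node foldl_rcons.
  exact: (refP _ IHs).2.
(* All colours met along all words. A word with one more letter is again a word, so there are at
   most [K] of them. *)
pose c := range (fun sv : seq W * W => (ref (node sv.1) sv.2).1).
have cK : c #<= [set: K].
  apply: (card_le_trans (card_image_le _ _)); apply: card_le_trans WK.
  by apply/card_leTP; exists (fun sv => sv.2 :: sv.1) => // -[s v] [t u] [-> ->].
(* Induction on the decomposition, for all words at once: refinement passes to a part that is not a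
   subsingleton, while the induction hypothesis makes it one. *)
suff node_c Q : decomposable J Q -> forall s, node s (c, Q) -> is_subset1 Q.
  by apply: nphi; apply: (node_c _ dphi [::]).
elim=> {Q} [//|Q g gmono _ IH s hQ].
have [|j [nj hj]] := (refP _ (u_node s)).1 c Q g hQ _ gmono.
  by move=> v; exists (s, v).
by case: nj; apply: (IH j (rcons s (w j))); rewrite /node foldl_rcons.
Qed.

End Colouring.

(** * The index order of the sums and the final assembly *)

Section MainTheorem.
Variables (K : cardinal) (k0 : K) (d : Order.disp_t) (phi : orderType d).

Definition sum_index (W : linorder) :=
  prod_order W (prod_order (wo phi) (rev_order (wo phi))).

(** Only the two factors beside [W] are enlarged: the layer over each [v] in [W] contains a
    homogeneous copy, whose colour is [tau v]. *)
Lemma sum_index_arrow (W : linorder) (p0 : phi) (C : Type) : scattered K W ->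
  exists J' : linorder, scattered K J' /\ forall chi : J' -> C,
    exists (e : sum_index W -> J') (tau : W -> C),
      mono_on setT e /\ forall j, chi (e j) = tau (tag j).
Proof.
move=> sW; pose M := wo (set (C * phi)).
have sM : scattered K M by exact: wellordered_scattered k0 (@wo_wellordered _).
exists (prod_order W (prod_order M (rev_order M))); split.
  by do 2![apply: sum_scattered => // _]; exact: rev_scattered.
have homM : homogeneous C M (wo phi) by exact: homogeneous_wo.
have hom := homogeneous_prod homM (homogeneous_rev homM).
move=> chi; have /choice[e /choice[tau eP]] v :=
  hom (fun y => chi (existT (fun=> car (prod_order M (rev_order M))) v y)).
exists (fun j => existT (fun=> car (prod_order M (rev_order M))) (tag j)
  (e (tag j) (tagged j))), tau; split; last by move=> [v y]; exact: (eP v).2.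
move=> [v x] [v' y] _ _ [vv'|[/= vv' xy]]; first by left.
by subst v'; apply/sum_before_fibre; exact: (eP v).1.
Qed.

End MainTheorem.

Theorem theorem6p2 (kappa : cardinal)
    (kappa_infinite : infinite_cardinal kappa)
    (kappa_weak_power : weak_power_self kappa)
    (d : Order.disp_t) (phi : orderType d)
    (phi_scattered : kscattered kappa phi)
    (nu : cardinal) :
  exists (d' : Order.disp_t) (psi : orderType d'),
    kscattered kappa psi /\ arrow1 psi phi nu kappa.
Proof.
have [k0 _] := infinite_pair kappa_infinite.
(* An order with at most one point is its own witness, as a copy of it uses at most one colour. *)
have [phi1|nphi] := EM (is_subset1 [set: phi]).
  exists d, phi; split=> // d0 P [g [gbij gmono]] f.
  exists (range (f \o g)), (range g); split.
  - apply: (card_le_trans (card_image_le _ _)); apply/card_leTP.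
    by exists (fun=> k0) => // x y _; exact: phi1.
  - exists g; split=> //; split=> [x _|x y _ _|_ [x _ <-]]; [by exists x| |by exists x].
    exact: (inc_inj gmono).
  - by move=> _ [x _ <-]; exists x.
have [W [sW WK W_univ]] := universal_small_order kappa_infinite kappa_weak_power.
have [p0] : $|phi|.
  by apply: contrapT => np; apply: nphi => x; case: np; squash x.
have [w0] : $|W|.
  have [|e _] := W_univ (of_order bool) setT; first exact: infinite_nleq_bool.
  by squash (e true).
pose J := sum_index phi W.
pose mkJ (v : W) (x y : phi) : J :=
  existT (fun=> car (prod_order (wo phi) (rev_order (wo phi)))) v
    (existT (fun=> car (rev_order (wo phi))) x y).
have dphi : decomposable J [set: phi].
  apply: (scattered_decomposable kappa_infinite _ _ _ phi_scattered).
  - move=> I S /W_univ[e emono]; exists (fun i => mkJ (e i) p0 p0) => x y Sx Sy xy.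
    by left; exact: emono.
  - exists (fun x => mkJ w0 x p0) => x y _ _ xy.
    by apply/sum_before_fibre; left.
  - exists (fun x => mkJ w0 p0 x) => x y _ _ xy.
    by apply/sum_before_fibre/sum_before_fibre.
have [|||||B [[b] sB BP]] :=
  @decomposable_arrow d phi nu kappa k0 J (mkJ w0 p0 p0) W (fun j => tag j).
- by move=> v; exists (mkJ v p0 p0).
- by move=> C; exact: sum_index_arrow.
- exact: seq_inj.
- exact: dphi.
- exact: nphi.
exists _, (order_of B : orderType _); split; first exact: order_of_scattered.
move=> d0 P [g [gbij gmono]] f.
have [c [cK [e [emono ec]]]] := BP (f \o g).
exists c, (range (g \o e)); split=> //; last by move=> _ [x _ <-]; exact: ec.
have emono' : {mono (e : phi -> order_of B) : x y / (x <= y)%O}.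
  by apply: le_mono => x y xy; apply/lt_order_of; exact: emono.
have gemono : {mono g \o (e : phi -> order_of B) : x y / (x <= y)%O}.
  by move=> x y; rewrite /= gmono emono'.
exists (g \o e); split=> //.
by split=> [x _|x y _ _ /(inc_inj gemono)//|_ [x _ <-]]; exists x.
Qed.
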